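(* Let $c \geq 4$ and let $G_1, G_2, \ldots, G_c$ be directed graphs on a common set of $n$ vertices. If $\sum_{i = 1}^c e(G_i) > \frac{c}{2}n^2$, then there exists a rainbow transitive triangle.
   Context: A directed graph $G$ consists of a vertex set $V(G)$ and an edge set $E(G)$ of ordered pairs of distinct vertices (no loops, no multiple edges; both $(u,v)$ and $(v,u)$ may be present). $e(G)=|E(G)|$. The edges of $G_i$ are thought of as having color $i$. A rainbow transitive triangle is a triple of distinct vertices $u,v,w$ together with pairwise distinct colors $a,b,d$ such that $(u,v)\in E(G_a)$, $(v,w)\in E(G_b)$, $(u,w)\in E(G_d)$. *)

(* Defs.v *)
From mathcomp Require Import all_boot all_order all_algebra.

Set Implicit Arguments.
Unset Strict Implicit.
Unset Printing Implicit Defensive.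

(* Both (u, v) and (v, u) may be edges. *)
Record digraph (V : finType) := Digraph {
  edges : {set V * V};
  edges_loopless : forall v : V, (v, v) \notin edges
}.

Definition num_edges (V : finType) (G : digraph V) : nat := #|edges G|.

Definition has_rainbow_transitive_triangle (V : finType) (c : nat)
    (G : 'I_c -> digraph V) : Prop :=
  exists (u v w : V) (a b d : 'I_c),
    [/\ uniq [:: u; v; w], uniq [:: a; b; d],
        (u, v) \in edges (G a), (v, w) \in edges (G b)
      & (u, w) \in edges (G d)].

(* Main.v *)
Require Import Defs.
From mathcomp Require Import all_boot all_order all_algebra.
From mathcomp Require Import zify.
From Stdlib Require Classical_Prop.

Set Implicit Arguments.
Unset Strict Implicit.
Unset Printing Implicit Defensive.

Import Order.TTheory GRing.Theory Num.Theory.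
Local Open Scope ring_scope.

(** Let [S u v] be the set of colors of the pair [(u, v)], and suppose that
    there is no rainbow transitive triangle. If every [S u v] has at most two
    elements, the sum of their sizes is at most [2n(n-1) <= (c/2)n^2].
    Otherwise some [S u v] has three colors; whatever two distinct colors are
    used between [x] and [u] and between [x] and [v], a third one remains for
    [(u, v)]. Hence none of the pairs [S u x], [S v x]; [S x u], [S x v];
    [S u x], [S x v] has distinct representatives, which forces the four sets
    between [x] and [{u, v}] to have total size at most [2c]. Deleting [u] and
    [v] thus loses at most [2c(n-2) + 2c = (c/2)(n^2 - (n-2)^2)], and induction
    on [n] applies. *)

(** When both sets are nonempty, an element of either one equals every element of the other. *)
Lemma card_no_distinct_representatives (I : finType) (A B : {set I}) :
    (forall a b, a \in A -> b \in B -> a = b) ->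
  [\/ #|A| = 0, #|B| = 0 | #|A| <= 1 /\ #|B| <= 1]%N.
Proof.
move=> AB; have [->|[a aA]] := set_0Vmem A; first by rewrite cards0; constructor 1.
have [->|[b bB]] := set_0Vmem B; first by rewrite cards0; constructor 2.
constructor 3; split.
  by rewrite -(cards1 b); apply/subset_leq_card/subsetP => x xA; rewrite inE (AB x b).
by rewrite -(cards1 a); apply/subset_leq_card/subsetP => x xB; rewrite inE (AB a x).
Qed.

Lemma sum_setD2 (V : finType) (f : V -> V -> nat) (W : {set V}) (u v : V) :
    u \in W -> v \in W :\ u ->
  (\sum_(x in W) \sum_(y in W) f x y =
   \sum_(x in W :\ u :\ v) \sum_(y in W :\ u :\ v) f x y
   + (f u u + f v v + f u v + f v u)
   + \sum_(x in W :\ u :\ v) (f u x + f x u + f v x + f x v))%N.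
Proof.
move=> uW vW; have split2 (g : V -> nat) :
    (\sum_(x in W) g x = g u + g v + \sum_(x in W :\ u :\ v) g x)%N.
  by rewrite (big_setD1 u) //= (big_setD1 v) //= addnA.
rewrite !split2 (eq_bigr _ (fun x _ => split2 (f x))) !big_split /=; lia.
Qed.

Section NoRainbowTriangle.

Variables (I V : finType) (S : V -> V -> {set I}).
Hypothesis no_triangle : forall u v w a b d,
  uniq [:: u; v; w] -> uniq [:: a; b; d] ->
  a \in S u v -> b \in S v w -> d \in S u w -> False.

Lemma card_edges_to_rich_pair (u v x : V) :
    (2 <= #|I|)%N -> (3 <= #|S u v|)%N -> uniq [:: u; v; x] ->
  (#|S u x| + #|S x u| + #|S v x| + #|S x v| <= 2 * #|I|)%N.
Proof.
move=> I2 Suv uvx.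
have third a b : exists2 d, d \in S u v & (d != a) && (d != b).
  have: ~~ (S u v \subset [set a; b]).
    by apply/negP => /subset_leq_card; rewrite cards2; lia.
  by case/subsetPn => d dS; rewrite !inE negb_or; exists d.
have xuv : uniq [:: x; u; v] by rewrite -(rot_uniq 1).
have uxv : uniq [:: u; x; v].
  by move: uvx; rewrite /= !inE (eq_sym x v) orbC.
(* [sink], [source] and [middle] name the place of [x] in a transitive triangle on [u], [v], [x]
   whose edge [(u, v)] takes the third color [d]. *)
have sink a b : a \in S u x -> b \in S v x -> a = b.
  move=> aS bS; apply/eqP; case: (altP (a =P b)) => // ab.
  have [d dS /andP[da db]] := third a b.
  case: (no_triangle uvx _ dS bS aS).
  by rewrite /= !inE negb_or db da eq_sym ab.
have source a b : a \in S x u -> b \in S x v -> a = b.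
  move=> aS bS; apply/eqP; case: (altP (a =P b)) => // ab.
  have [d dS /andP[da db]] := third a b.
  case: (no_triangle xuv _ aS dS bS).
  by rewrite /= !inE negb_or ab db eq_sym da.
have middle a b : a \in S u x -> b \in S x v -> a = b.
  move=> aS bS; apply/eqP; case: (altP (a =P b)) => // ab.
  have [d dS /andP[da db]] := third a b.
  case: (no_triangle uxv _ aS bS dS).
  by rewrite /= !inE negb_or ab eq_sym da eq_sym db.
have := card_no_distinct_representatives sink.
have := card_no_distinct_representatives source.
have := card_no_distinct_representatives middle.
have := max_card (S u x); have := max_card (S x u).
have := max_card (S v x); have := max_card (S x v).
(* Each of the pairs [S u x], [S v x] and [S x u], [S x v] has total size at most the maximum of
   [#|I|] and 2, which is [#|I|]. *)
by move=> ? ? ? ? [?|?|[? ?]] [?|?|[? ?]] [?|?|[? ?]]; lia.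
Qed.

Hypothesis loopless : forall v, S v v = set0.

(** Stating the bound for subsets [W] lets the induction delete vertices inside a fixed [V]; the
    factor 2 clears the denominator of c/2. *)
Lemma sum_card_colors_le (W : {set V}) : (4 <= #|I|)%N ->
  (2 * \sum_(x in W) \sum_(y in W) #|S x y| <= #|I| * #|W| ^ 2)%N.
Proof.
move=> I4; have [m] := ubnP #|W|; elim: m W => // m IHm W Wm.
have [/exists_inP[u uW /exists_inP[v vW Suv]]|poor] :=
    boolP [exists u in W, exists v in W, 3 <= #|S u v|]%N; last first.
  have bound : (\sum_(x in W) \sum_(y in W) #|S x y| <= #|W| * (#|W| * 2))%N.
    rewrite -!sum_nat_const; apply: leq_sum => x xW; apply: leq_sum => y yW.
    rewrite leqNgt; apply: contra poor => Sxy.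
    by apply/exists_inP; exists x => //; apply/exists_inP; exists y.
  have : (4 * #|W| ^ 2 <= #|I| * #|W| ^ 2)%N by rewrite leq_mul2r I4 orbT.
  by nia.
have vu : v != u by apply: contraTneq Suv => ->; rewrite loopless cards0.
have vWu : v \in W :\ u by rewrite !inE vu.
have cardW : #|W| = (#|W :\ u :\ v| + 2)%N.
  by rewrite (cardsD1 u W) uW (cardsD1 v (W :\ u)) vWu; lia.
rewrite (sum_setD2 _ uW vWu) !loopless cards0.
have : (\sum_(x in W :\ u :\ v) (#|S u x| + #|S x u| + #|S v x| + #|S x v|)
          <= #|W :\ u :\ v| * (2 * #|I|))%N.
  rewrite -sum_nat_const; apply: leq_sum => x; rewrite !inE => /and3P[xv xu _].
  apply: card_edges_to_rich_pair => //; first by lia.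
  by rewrite /= !inE negb_or !(eq_sym _ x) eq_sym vu xu xv.
(* With k the size of [W :\ u :\ v], induction, the pair [u], [v] and the cross terms bound the
   doubled sum by [#|I|] times k^2 + 4 + 4k = (k + 2)^2. *)
have := IHm (W :\ u :\ v); have := max_card (S u v); have := max_card (S v u).
by rewrite cardW in Wm *; nia.
Qed.

End NoRainbowTriangle.

Theorem theorem7 (c n : nat) (V : finType) (G : 'I_c -> digraph V)
    (hc : (4 <= c)%N) (hV : #|V| = n)
    (hsum : (c%:R / 2%:R) * n%:R ^+ 2
              < (\sum_(i < c) num_edges (G i))%N%:R :> rat) :
  has_rainbow_transitive_triangle G.
Proof.
pose S u v := [set i | (u, v) \in edges (G i)].
apply: Classical_Prop.NNPP => noT.
have no_triangle u v w a b d : uniq [:: u; v; w] -> uniq [:: a; b; d] ->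
    a \in S u v -> b \in S v w -> d \in S u w -> False.
  by rewrite !inE => *; apply: noT; exists u, v, w, a, b, d.
have loopless v : S v v = set0.
  by apply/setP => i; rewrite !inE (negPf (edges_loopless _ _)).
have := sum_card_colors_le no_triangle loopless setT.
rewrite card_ord cardsT hV => /(_ hc).
(* Double counting of the incidences between vertex pairs and colors. *)
have -> : (\sum_(x in setT) \sum_(y in setT) #|S x y| =
           \sum_(i < c) num_edges (G i))%N.
  under eq_bigl do rewrite inE.
  under eq_bigr => x _ do under eq_bigl do rewrite inE.
  rewrite pair_big /=.
  under eq_bigr => p _ do rewrite -sum1dep_card big_mkcond.
  rewrite exchange_big; apply: eq_bigr => i _.
  rewrite /num_edges -sum1_card [RHS]big_mkcond.
  by apply: eq_bigr => -[x y] _.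
rewrite leqNgt => /negP[]; move: hsum.
by rewrite mulrAC ltr_pdivrMr // -natrX -!natrM ltr_nat mulnC [X in (_ < X)%N]mulnC.
Qed.
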